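(* Let $(\mathcal S,\Sigma)$ be a monoidal signature and $\mathbb I$ a set of pairs $(t_1,t_2)$ of tapes of $\mathsf T_\Sigma$ with the same domain and codomain. Let $\lesssim_{\mathbb I}$ be the smallest relation on tapes containing $\mathbb I$ that is reflexive, transitive, and closed under $\oplus$, $\otimes$ and $;$ (i.e. $t_1\lesssim t_2$, $s_1\lesssim s_2$ imply $t_1\oplus s_1\lesssim t_2\oplus s_2$, $t_1\otimes s_1\lesssim t_2\otimes s_2$, $t_1;s_1\lesssim t_2;s_2$ when defined). Let $W(\mathbb I)=\{(R_U(t_1),R_U(t_2))\mid (t_1,t_2)\in\mathbb I,\ U\in\mathcal S^\star\}$ and let $\lesssim'$ be the smallest relation containing $W(\mathbb I)$ that is reflexive, transitive and closed under $\oplus$ and $;$ (but not required to be closed under $\otimes$). Then for all tapes $t_1,t_2$: $t_1\lesssim_{\mathbb I}t_2$ if and only if $t_1\lesssim' t_2$.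
   Context: A monoidal signature: sorts $\mathcal S$ and generators $s$ with arity and coarity in $\mathcal S^\star$; $\mathsf C_\Sigma$ the free strict symmetric monoidal category on it ($\otimes$ concatenation, unit the empty word). A finite biproduct (fb) category: symmetric monoidal $(\mathsf C,\oplus,0)$ with natural commutative monoids $\nabla_X:X\oplus X\to X$, $\mathsf i_X:0\to X$ and cocommutative comonoids $\Delta_X:X\to X\oplus X$, $!_X:X\to0$ coherent with $\oplus$. $\mathsf T_\Sigma$ is the free strict fb category on the underlying category of $\mathsf C_\Sigma$: objects polynomials $P=U_1\oplus\cdots\oplus U_n$ ($U_i\in\mathcal S^\star$); arrows (tapes) are terms in $\mathrm{id}_U,\mathrm{id}_0$, $\lceil c\rceil$ ($c:U\to V$ in $\mathsf C_\Sigma$), $\sigma^\oplus_{U,V}$, $\Delta_U,!_U,\nabla_U,\mathsf i_U$, $;$, $\oplus$ modulo the strict symmetric monoidal, (co)monoid and bialgebra laws, naturality of $\Delta,!,\nabla,\mathsf i$ w.r.t. $\lceil c\rceil$, $\lceil\mathrm{id}\rceil=\mathrm{id}$, $\lceil c;d\rceil=\lceil c\rceil;\lceil d\rceil$. Product $\otimes$: on objects $(\bigoplus_iU_i)\otimes(\bigoplus_jV_j)=\bigoplus_i\bigoplus_jU_iV_j$. For a monomial $U$, $L_U,R_U$ preserve $;$, $\oplus$, $\mathrm{id}_0$, with $L_U(\lceil c\rceil)=\lceil\mathrm{id}_U\otimes c\rceil$, $R_U(\lceil c\rceil)=\lceil c\otimes\mathrm{id}_U\rceil$, $L_U(\sigma^\oplus_{V,W})=\sigma^\oplus_{UV,UW}$,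 $R_U(\sigma^\oplus_{V,W})=\sigma^\oplus_{VU,WU}$, $L_U(\Delta_V)=\Delta_{UV}$, $R_U(\Delta_V)=\Delta_{VU}$ and likewise for $!,\nabla,\mathsf i$. Left distributor: $\delta^l_{0,Q,R}=\mathrm{id}_0$, $\delta^l_{U\oplus P',Q,R}=(\mathrm{id}_{U\otimes(Q\oplus R)}\oplus\delta^l_{P',Q,R});(\mathrm{id}_{U\otimes Q}\oplus\sigma^\oplus_{U\otimes R,P'\otimes Q}\oplus\mathrm{id}_{P'\otimes R})$. For polynomial $S$ and $t:P\to Q$: $L_0(t)=R_0(t)=\mathrm{id}_0$, $L_{W\oplus S'}(t)=L_W(t)\oplus L_{S'}(t)$, $R_{W\oplus S'}(t)=\delta^l_{P,W,S'};(R_W(t)\oplus R_{S'}(t));(\delta^l_{Q,W,S'})^{-1}$. For $t_1:P_1\to Q_1$, $t_2:P_2\to Q_2$: $t_1\otimes t_2=L_{P_1}(t_2);R_{Q_2}(t_1)$. *)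

(* Defs.v *)
From mathcomp Require Import ssreflect ssrfun ssrbool eqtype ssrnat seq.

Set Implicit Arguments.
Unset Strict Implicit.
Unset Printing Implicit Defensive.

(** Arrows are represented by raw terms; [dom] and [cod] are computed on raw
    terms and a separate predicate selects the well-typed ones.  Objects are
    sequences, so strictness (associativity and unit laws on objects) is plain
    equality of sequences and no transport along it is ever needed.  Arrows of
    the free categories are well-typed terms taken up to the relations [ceq] and
    [teq] below, which relate well-typed parallel terms only. *)

Record signature := Signature {
  sort : Type;
  gen : Type;
  arity : gen -> seq sort;
  coarity : gen -> seq sort }.

Definition word (Sg : signature) := seq (sort Sg).

Declare Scope circuit_scope.
Delimit Scope circuit_scope with circ.
Declare Scope tape_scope.
Delimit Scope tape_scope with tape.

Inductive circuit (Sg : signature) : Type :=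
| CId of word Sg
| CGen of gen Sg
| CSym of word Sg & word Sg
| CComp of circuit Sg & circuit Sg
| CTens of circuit Sg & circuit Sg.

Arguments CId {Sg}.
Arguments CGen {Sg}.
Arguments CSym {Sg}.
Bind Scope circuit_scope with circuit.
Notation "c ;; d" := (CComp c d)
  (at level 50, left associativity) : circuit_scope.
Notation "c ** d" := (CTens c d)
  (at level 45, left associativity) : circuit_scope.

Section Circuits.
Variable Sg : signature.
Implicit Types (c d e : circuit Sg) (U V W : word Sg).

Fixpoint cdom c : word Sg :=
  match c with
  | CId U => U
  | CGen s => arity s
  | CSym U V => U ++ V
  | CComp c _ => cdom c
  | CTens c d => cdom c ++ cdom d
  end.

Fixpoint ccod c : word Sg :=
  match c with
  | CId U => U
  | CGen s => coarity s
  | CSym U V => V ++ U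
  | CComp _ d => ccod d
  | CTens c d => ccod c ++ ccod d
  end.

Fixpoint cwf c : Prop :=
  match c with
  | CComp c d => [/\ cwf c, cwf d & ccod c = cdom d]
  | CTens c d => cwf c /\ cwf d
  | _ => True
  end.

Local Open Scope circuit_scope.

Inductive ceq : circuit Sg -> circuit Sg -> Prop :=
| ceq_refl c : cwf c -> ceq c c
| ceq_sym c d : ceq c d -> ceq d c
| ceq_trans c d e : ceq c d -> ceq d e -> ceq c e
| ceq_comp c c' d d' : ccod c = cdom d ->
    ceq c c' -> ceq d d' -> ceq (c ;; d) (c' ;; d')
| ceq_tens c c' d d' :
    ceq c c' -> ceq d d' -> ceq (c ** d) (c' ** d')
| ceq_compA c d e : cwf (c ;; d ;; e) ->
    ceq (c ;; d ;; e) (c ;; (d ;; e))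
| ceq_idl c : cwf c -> ceq (CId (cdom c) ;; c) c
| ceq_idr c : cwf c -> ceq (c ;; CId (ccod c)) c
| ceq_tensA c d e : cwf (c ** d ** e) ->
    ceq (c ** d ** e) (c ** (d ** e))
| ceq_unitl c : cwf c -> ceq (CId [::] ** c) c
| ceq_unitr c : cwf c -> ceq (c ** CId [::]) c
| ceq_tens_id U V : ceq (CId U ** CId V) (CId (U ++ V))
| ceq_interchange c c' d d' : cwf (c ;; c') -> cwf (d ;; d') ->
    ceq ((c ;; c') ** (d ;; d')) ((c ** d) ;; (c' ** d'))
| ceq_symK U V : ceq (CSym U V ;; CSym V U) (CId (U ++ V))
| ceq_sym_nat c d : cwf c -> cwf d ->
    ceq ((c ** d) ;; CSym (ccod c) (ccod d))
        (CSym (cdom c) (cdom d) ;; (d ** c))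
| ceq_hexl U V W :
    ceq (CSym (U ++ V) W)
        ((CId U ** CSym V W) ;; (CSym U W ** CId V))
| ceq_hexr U V W :
    ceq (CSym U (V ++ W))
        ((CSym U V ** CId W) ;; (CId V ** CSym U W)).

Lemma ceq_wf c d : ceq c d ->
  [/\ cwf c, cwf d, cdom c = cdom d & ccod c = ccod d].
Proof.
elim=> {c d} /=; try by intros; intuition (rewrite ?cats0 ?catA //; congruence).
- by move=> c d _ [].
- by move=> c d e _ [? ? -> ->] _ [].
- by move=> c c' d d' h _ [? ? e1 e2] _ [? ? e3 e4]; split=> //;
    split=> //; congruence.
- by move=> c c' d d' _ [? ? -> ->] _ [? ? -> ->].
- by move=> c d e [] [? ? h] ? h'; split=> //; split.
- by move=> c c' d d' [? ? ->] [? ? ->].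
Qed.

End Circuits.

(** A polynomial U_1 (+) ... (+) U_n is the sequence of its monomials; the
    monomial U seen as a polynomial is [[:: U]]. *)
Definition poly (Sg : signature) := seq (word Sg).

Inductive tape (Sg : signature) : Type :=
| TId0
| TId of word Sg
| TCirc of circuit Sg
| TSym of word Sg & word Sg
| TCopy of word Sg    (* Delta *)
| TDisc of word Sg    (* !     *)
| TMerge of word Sg   (* nabla *)
| TInit of word Sg    (* i     *)
| TComp of tape Sg & tape Sg
| TSum of tape Sg & tape Sg.

Arguments TId0 {Sg}.
Arguments TId {Sg}.
Arguments TSym {Sg}.
Arguments TCopy {Sg}.
Arguments TDisc {Sg}.
Arguments TMerge {Sg}.
Arguments TInit {Sg}.
Bind Scope tape_scope with tape.
Notation "t ;; s" := (TComp t s) (at level 50, left associativity) : tape_scope.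
Notation "t <+> s" := (TSum t s) (at level 45, left associativity) : tape_scope.

Section Tapes.
Variable Sg : signature.
Implicit Types (t s r : tape Sg) (c d : circuit Sg).
Implicit Types (U V W : word Sg) (P Q R S : poly Sg).

Fixpoint dom t : poly Sg :=
  match t with
  | TId0 => [::]
  | TId U => [:: U]
  | TCirc c => [:: cdom c]
  | TSym U V => [:: U; V]
  | TCopy U => [:: U]
  | TDisc U => [:: U]
  | TMerge U => [:: U; U]
  | TInit U => [::]
  | TComp t _ => dom t
  | TSum t s => dom t ++ dom s
  end.

Fixpoint cod t : poly Sg :=
  match t with
  | TId0 => [::]
  | TId U => [:: U]
  | TCirc c => [:: ccod c]
  | TSym U V => [:: V; U]
  | TCopy U => [:: U; U]
  | TDisc U => [::]
  | TMerge U => [:: U]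
  | TInit U => [:: U]
  | TComp _ s => cod s
  | TSum t s => cod t ++ cod s
  end.

Fixpoint wf t : Prop :=
  match t with
  | TCirc c => cwf c
  | TComp t s => [/\ wf t, wf s & cod t = dom s]
  | TSum t s => wf t /\ wf s
  | _ => True
  end.

Definition parallel t s := [/\ wf t, wf s, dom t = dom s & cod t = cod s].

Local Open Scope tape_scope.

Fixpoint idP P : tape Sg :=
  if P is U :: P' then TId U <+> idP P' else TId0.

(** Symmetries at polynomials, forced by the hexagon laws. *)
Fixpoint symU U Q : tape Sg :=
  if Q is V :: Q' then (TSym U V <+> idP Q') ;; (TId V <+> symU U Q')
  else TId U.

Fixpoint symP P Q : tape Sg :=
  if P is U :: P' then (TId U <+> symP P' Q) ;; (symU U Q <+> idP P')
  else idP Q.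

Inductive teq : tape Sg -> tape Sg -> Prop :=
| teq_refl t : wf t -> teq t t
| teq_sym t s : teq t s -> teq s t
| teq_trans t s r : teq t s -> teq s r -> teq t r
| teq_comp t t' s s' : cod t = dom s ->
    teq t t' -> teq s s' -> teq (t ;; s) (t' ;; s')
| teq_sum t t' s s' :
    teq t t' -> teq s s' -> teq (t <+> s) (t' <+> s')
| teq_compA t s r : wf (t ;; s ;; r) ->
    teq (t ;; s ;; r) (t ;; (s ;; r))
| teq_idl t : wf t -> teq (idP (dom t) ;; t) t
| teq_idr t : wf t -> teq (t ;; idP (cod t)) t
| teq_sumA t s r : wf (t <+> s <+> r) ->
    teq (t <+> s <+> r) (t <+> (s <+> r))
| teq_unitl t : wf t -> teq (TId0 <+> t) t
| teq_unitr t : wf t -> teq (t <+> TId0) t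
| teq_interchange t t' s s' : wf (t ;; t') -> wf (s ;; s') ->
    teq ((t ;; t') <+> (s ;; s')) ((t <+> s) ;; (t' <+> s'))
| teq_symK P Q : teq (symP P Q ;; symP Q P) (idP (P ++ Q))
| teq_sym_nat t s : wf t -> wf s ->
    teq ((t <+> s) ;; symP (cod t) (cod s))
        (symP (dom t) (dom s) ;; (s <+> t))
| teq_copyA U :
    teq (TCopy U ;; (TCopy U <+> TId U)) (TCopy U ;; (TId U <+> TCopy U))
| teq_copy_disc U : teq (TCopy U ;; (TDisc U <+> TId U)) (TId U)
| teq_copyC U : teq (TCopy U ;; TSym U U) (TCopy U)
| teq_mergeA U :
    teq ((TMerge U <+> TId U) ;; TMerge U) ((TId U <+> TMerge U) ;; TMerge U)
| teq_merge_init U : teq ((TInit U <+> TId U) ;; TMerge U) (TId U)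
| teq_mergeC U : teq (TSym U U ;; TMerge U) (TMerge U)
| teq_merge_copy U :
    teq (TMerge U ;; TCopy U)
        ((TCopy U <+> TCopy U) ;; (TId U <+> TSym U U <+> TId U) ;;
         (TMerge U <+> TMerge U))
| teq_merge_disc U : teq (TMerge U ;; TDisc U) (TDisc U <+> TDisc U)
| teq_init_copy U : teq (TInit U ;; TCopy U) (TInit U <+> TInit U)
| teq_init_disc U : teq (TInit U ;; TDisc U) TId0
| teq_copy_nat c : cwf c ->
    teq (TCirc c ;; TCopy (ccod c)) (TCopy (cdom c) ;; (TCirc c <+> TCirc c))
| teq_disc_nat c : cwf c ->
    teq (TCirc c ;; TDisc (ccod c)) (TDisc (cdom c))
| teq_merge_nat c : cwf c ->
    teq (TMerge (cdom c) ;; TCirc c) ((TCirc c <+> TCirc c) ;; TMerge (ccod c))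
| teq_init_nat c : cwf c ->
    teq (TInit (cdom c) ;; TCirc c) (TInit (ccod c))
| teq_circ c d : ceq c d -> teq (TCirc c) (TCirc d)
| teq_circ_id U : teq (TCirc (CId U)) (TId U)
| teq_circ_comp c d : cwf (c ;; d)%circ ->
    teq (TCirc (c ;; d)%circ) (TCirc c ;; TCirc d).

(** [map (cat U) Q] is U (x) Q, that is, the first block of
    [pprod (U :: P) Q]. *)
Definition pprod P Q : poly Sg := [seq U ++ V | U <- P, V <- Q].

Fixpoint whiskL U t : tape Sg :=
  match t with
  | TId0 => TId0
  | TId V => TId (U ++ V)
  | TCirc c => TCirc (CId U ** c)%circ
  | TSym V W => TSym (U ++ V) (U ++ W)
  | TCopy V => TCopy (U ++ V)
  | TDisc V => TDisc (U ++ V)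
  | TMerge V => TMerge (U ++ V)
  | TInit V => TInit (U ++ V)
  | TComp t s => whiskL U t ;; whiskL U s
  | TSum t s => whiskL U t <+> whiskL U s
  end.

Fixpoint whiskR U t : tape Sg :=
  match t with
  | TId0 => TId0
  | TId V => TId (V ++ U)
  | TCirc c => TCirc (c ** CId U)%circ
  | TSym V W => TSym (V ++ U) (W ++ U)
  | TCopy V => TCopy (V ++ U)
  | TDisc V => TDisc (V ++ U)
  | TMerge V => TMerge (V ++ U)
  | TInit V => TInit (V ++ U)
  | TComp t s => whiskR U t ;; whiskR U s
  | TSum t s => whiskR U t <+> whiskR U s
  end.

Fixpoint distl P Q R : tape Sg :=
  if P is U :: P' then
    (idP (map (cat U) (Q ++ R)) <+> distl P' Q R) ;;
    (idP (map (cat U) Q) <+> symP (map (cat U) R) (pprod P' Q)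
                         <+> idP (pprod P' R))
  else TId0.

(** The inverse of [distl]; see [distlK] and [distl_invK]. *)
Fixpoint distl_inv P Q R : tape Sg :=
  if P is U :: P' then
    (idP (map (cat U) Q) <+> symP (pprod P' Q) (map (cat U) R)
                         <+> idP (pprod P' R)) ;;
    (idP (map (cat U) (Q ++ R)) <+> distl_inv P' Q R)
  else TId0.

Fixpoint whiskLP S t : tape Sg :=
  if S is W :: S' then whiskL W t <+> whiskLP S' t else TId0.

Fixpoint whiskRP S t : tape Sg :=
  if S is W :: S' then
    distl (dom t) [:: W] S' ;;
    (whiskR W t <+> whiskRP S' t) ;;
    distl_inv (cod t) [:: W] S'
  else TId0.

Definition tens t s : tape Sg := whiskLP (dom t) s ;; whiskRP (cod s) t.

(** Sets of pairs of tapes are relations on terms; since tapes are terms up to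
    [teq], reflexivity is stated up to [teq], which makes the relations
    invariant under [teq]. *)

Inductive tle (I : tape Sg -> tape Sg -> Prop) : tape Sg -> tape Sg -> Prop :=
| tle_base t1 t2 : I t1 t2 -> tle I t1 t2
| tle_refl t1 t2 : teq t1 t2 -> tle I t1 t2
| tle_trans t1 t2 t3 : tle I t1 t2 -> tle I t2 t3 -> tle I t1 t3
| tle_sum t1 t2 s1 s2 :
    tle I t1 t2 -> tle I s1 s2 -> tle I (t1 <+> s1) (t2 <+> s2)
| tle_tens t1 t2 s1 s2 :
    tle I t1 t2 -> tle I s1 s2 -> tle I (tens t1 s1) (tens t2 s2)
| tle_comp t1 t2 s1 s2 : cod t1 = dom s1 ->
    tle I t1 t2 -> tle I s1 s2 -> tle I (t1 ;; s1) (t2 ;; s2).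

Inductive tle' (J : tape Sg -> tape Sg -> Prop) : tape Sg -> tape Sg -> Prop :=
| tle'_base t1 t2 : J t1 t2 -> tle' J t1 t2
| tle'_refl t1 t2 : teq t1 t2 -> tle' J t1 t2
| tle'_trans t1 t2 t3 : tle' J t1 t2 -> tle' J t2 t3 -> tle' J t1 t3
| tle'_sum t1 t2 s1 s2 :
    tle' J t1 t2 -> tle' J s1 s2 -> tle' J (t1 <+> s1) (t2 <+> s2)
| tle'_comp t1 t2 s1 s2 : cod t1 = dom s1 ->
    tle' J t1 t2 -> tle' J s1 s2 -> tle' J (t1 ;; s1) (t2 ;; s2).

Definition whisk_closure (I : tape Sg -> tape Sg -> Prop) : tape Sg -> tape Sg -> Prop :=
  fun s1 s2 => exists U t1 t2,
    [/\ I t1 t2, s1 = whiskR U t1 & s2 = whiskR U t2].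

Definition typed t P Q := [/\ wf t, dom t = P & cod t = Q].

Lemma typed_comp t s P Q R : typed t P Q -> typed s Q R -> typed (t ;; s) P R.
Proof. by case=> ? <- h [? e <-]; split=> //; split=> //; rewrite h e. Qed.

Lemma typed_sum t s P Q P' Q' :
  typed t P Q -> typed s P' Q' -> typed (t <+> s) (P ++ P') (Q ++ Q').
Proof. by case=> ? <- <- [? <- <-]. Qed.

Lemma typed_wf t : wf t -> typed t (dom t) (cod t).
Proof. by []. Qed.

Lemma typed_id P : typed (idP P) P P.
Proof.
by elim: P => //= U P [h1 h2 h3]; split; rewrite /= ?h2 ?h3.
Qed.

Lemma typed_symU U Q : typed (symU U Q) (U :: Q) (rcons Q U).
Proof.
elim: Q => //= V Q ih; apply: typed_comp.
  exact: (@typed_sum (TSym U V) _ [:: U; V] [:: V; U] _ _ _ (typed_id Q)).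
exact: (@typed_sum (TId V) _ [:: V] [:: V] _ _ _ ih).
Qed.

Lemma typed_sym P Q : typed (symP P Q) (P ++ Q) (Q ++ P).
Proof.
elim: P => [|U P ih] /=; first by rewrite cats0; exact: typed_id.
apply: typed_comp; first exact: (@typed_sum (TId U) _ [:: U] [:: U] _ _ _ ih).
rewrite -cat_rcons; apply: (typed_sum (typed_symU U Q) (typed_id P)).
Qed.

Lemma teq_parallel t s : teq t s -> parallel t s.
Proof.
have idE P : typed (idP P) P P by exact: typed_id.
have symE P Q : typed (symP P Q) (P ++ Q) (Q ++ P) by exact: typed_sym.
rewrite /parallel.
elim=> {t s} /=; try by intros; intuition (rewrite ?cats0 ?catA //; congruence).
- by move=> t s _ [].
- by move=> t s r _ [? ? -> ->] _ [].
- by move=> t t' s s' h _ [? ? e1 e2] _ [? ? e3 e4]; split=> //;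
    split=> //; congruence.
- by move=> t t' s s' _ [? ? -> ->] _ [? ? -> ->].
- by move=> t s r [] [? ? h] ? h'; split=> //; split.
- by move=> t wt; have [? -> ->] := idE (dom t).
- by move=> t wt; have [? -> ->] := idE (cod t).
- by move=> t t' s s' [? ? ->] [? ? ->].
- move=> P Q; have [h1 -> ->] := symE P Q; have [h2 -> ->] := symE Q P.
  by have [h3 -> ->] := idE (P ++ Q).
- move=> t s wt ws; have [h1 -> ->] := symE (cod t) (cod s).
  by have [h2 -> ->] := symE (dom t) (dom s).
- by move=> c d /ceq_wf [? ? -> ->].
- by move=> c d [? ? h]; split=> //; split=> //; rewrite h.
Qed.

Lemma typed_whiskL U t P Q :
  typed t P Q -> typed (whiskL U t) (map (cat U) P) (map (cat U) Q).
Proof.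
case=> w <- <- {P Q}; have domE s : dom (whiskL U s) = map (cat U) (dom s).
  by elim: s => //= s -> r ->; rewrite map_cat.
have codE s : cod (whiskL U s) = map (cat U) (cod s).
  by elim: s => //= s -> r ->; rewrite map_cat.
split=> //; elim: t w => //= t iht s ihs; last by case=> /iht ? /ihs.
by case=> /iht ? /ihs ? e; split=> //; rewrite codE domE e.
Qed.

Lemma typed_whiskR U t P Q :
  typed t P Q -> typed (whiskR U t) (map (cat^~ U) P) (map (cat^~ U) Q).
Proof.
case=> w <- <- {P Q}; have domE s : dom (whiskR U s) = map (cat^~ U) (dom s).
  by elim: s => //= s -> r ->; rewrite map_cat.
have codE s : cod (whiskR U s) = map (cat^~ U) (cod s).
  by elim: s => //= s -> r ->; rewrite map_cat.
split=> //; elim: t w => //= t iht s ihs; last by case=> /iht ? /ihs.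
by case=> /iht ? /ihs ? e; split=> //; rewrite codE domE e.
Qed.

Lemma typed_distl P Q R :
  typed (distl P Q R) (pprod P (Q ++ R)) (pprod P Q ++ pprod P R).
Proof.
elim: P => //= U P ih; apply: typed_comp.
  exact: typed_sum (typed_id _) ih.
have -> : map (cat U) (Q ++ R) ++ pprod P Q ++ pprod P R
  = (map (cat U) Q ++ map (cat U) R ++ pprod P Q) ++ pprod P R.
  by rewrite map_cat !catA.
have -> : (map (cat U) Q ++ pprod P Q) ++ map (cat U) R ++ pprod P R
  = (map (cat U) Q ++ pprod P Q ++ map (cat U) R) ++ pprod P R.
  by rewrite !catA.
exact: typed_sum (typed_sum (typed_id _) (typed_sym _ _)) (typed_id _).
Qed.

Lemma typed_distl_inv P Q R :
  typed (distl_inv P Q R) (pprod P Q ++ pprod P R) (pprod P (Q ++ R)).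
Proof.
elim: P => //= U P ih; apply: typed_comp; last first.
  exact: typed_sum (typed_id _) ih.
have -> : map (cat U) (Q ++ R) ++ pprod P Q ++ pprod P R
  = (map (cat U) Q ++ map (cat U) R ++ pprod P Q) ++ pprod P R.
  by rewrite map_cat !catA.
have -> : (map (cat U) Q ++ pprod P Q) ++ map (cat U) R ++ pprod P R
  = (map (cat U) Q ++ pprod P Q ++ map (cat U) R) ++ pprod P R.
  by rewrite !catA.
exact: typed_sum (typed_sum (typed_id _) (typed_sym _ _)) (typed_id _).
Qed.

Lemma typed_whiskLP S t P Q :
  typed t P Q -> typed (whiskLP S t) (pprod S P) (pprod S Q).
Proof.
by move=> tt; elim: S => //= W S; apply: typed_sum; apply: typed_whiskL.
Qed.

Lemma pprod0 P : pprod P [::] = [::].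
Proof. by elim: P. Qed.

Lemma pprod1 P W : pprod P [:: W] = map (cat^~ W) P.
Proof. by elim: P => //= U P <-. Qed.

Lemma typed_whiskRP S t P Q :
  typed t P Q -> typed (whiskRP S t) (pprod P S) (pprod Q S).
Proof.
move=> tt; elim: S => [|W S ih] /=; first by rewrite !pprod0.
have [_ -> ->] := tt; apply: typed_comp (typed_distl_inv _ _ _).
apply: typed_comp (typed_distl _ _ _) _.
by rewrite !pprod1; apply: typed_sum ih; apply: typed_whiskR.
Qed.

Lemma typed_tens t1 t2 P1 Q1 P2 Q2 : typed t1 P1 Q1 -> typed t2 P2 Q2 ->
  typed (tens t1 t2) (pprod P1 P2) (pprod Q1 Q2).
Proof.
move=> h1 h2; rewrite /tens; have [_ -> _] := h1; have [_ _ ->] := h2.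
by apply: typed_comp (typed_whiskLP _ h2) (typed_whiskRP _ h1).
Qed.

Lemma teq_id_cat P Q : teq (idP P <+> idP Q) (idP (P ++ Q)).
Proof.
have w R : wf (idP R) by have [] := typed_id R.
elim: P => [|U P ih] /=; first exact: teq_unitl.
apply: teq_trans (teq_sumA _) _; first by rewrite /=.
by apply: teq_sum ih; apply: teq_refl.
Qed.

Lemma teq_idK P : teq (idP P ;; idP P) (idP P).
Proof.
by have [w d _] := typed_id P; rewrite -{1}d; apply: teq_idl.
Qed.

Lemma teq_cancel P Q t t' s s' : typed t P Q -> typed t' Q P ->
  teq (t ;; t') (idP P) -> teq (s ;; s') (idP Q) ->
  teq ((t ;; s) ;; (s' ;; t')) (idP P).
Proof.
move=> [wt dt ct] [wt' dt' ct'] et es.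
have [[ws ws' css'] _] := teq_parallel es; have [_ -> ->] := typed_id Q.
rewrite /= => ds cs'.
have wA : wf (t ;; s ;; (s' ;; t')).
  by rewrite /= ct ds cs' dt'.
apply: teq_trans (teq_compA _) _; first by [].
apply: teq_trans et; apply: teq_comp; rewrite /= ?ct //; first exact: teq_refl.
apply: teq_trans (teq_sym (teq_compA _)) _; first by rewrite /= cs' dt'.
apply: (@teq_trans _ (idP Q ;; t')); last by rewrite -dt'; apply: teq_idl.
by apply: teq_comp es (teq_refl _); rewrite //= cs' dt'.
Qed.

Lemma teq_sum_id t t' s s' P Q : teq (t ;; t') (idP P) ->
  teq (s ;; s') (idP Q) -> teq ((t <+> s) ;; (t' <+> s')) (idP (P ++ Q)).
Proof.
move=> e f; have [we _ _ _] := teq_parallel e.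
have [wf' _ _ _] := teq_parallel f.
apply: teq_trans (teq_sym (teq_interchange we wf')) _.
by apply: teq_trans (teq_id_cat _ _); apply: teq_sum.
Qed.

Lemma distlK P Q R :
  teq (distl P Q R ;; distl_inv P Q R) (idP (pprod P (Q ++ R))).
Proof.
elim: P => [|U P ih] /=; first exact: (@teq_idl TId0).
have tA := typed_id (map (cat U) (Q ++ R)).
have t1 := typed_sum tA (typed_distl P Q R).
have t2 := typed_sum tA (typed_distl_inv P Q R).
apply: (teq_cancel t1 t2); first exact: teq_sum_id (teq_idK _) ih.
have -> : map (cat U) (Q ++ R) ++ pprod P Q ++ pprod P R
  = (map (cat U) Q ++ map (cat U) R ++ pprod P Q) ++ pprod P R.
  by rewrite map_cat !catA.
by apply: teq_sum_id (teq_idK _); apply: teq_sum_id (teq_idK _) (teq_symK _ _).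
Qed.

Lemma distl_invK P Q R :
  teq (distl_inv P Q R ;; distl P Q R) (idP (pprod P Q ++ pprod P R)).
Proof.
elim: P => [|U P ih] /=; first exact: (@teq_idl TId0).
have tB := typed_id (map (cat U) Q); have tC := typed_id (pprod P R).
have t1 := typed_sum (typed_sum tB (typed_sym (pprod P Q) (map (cat U) R))) tC.
have t2 := typed_sum (typed_sum tB (typed_sym (map (cat U) R) (pprod P Q))) tC.
have -> : (map (cat U) Q ++ pprod P Q) ++ map (cat U) R ++ pprod P R
  = (map (cat U) Q ++ pprod P Q ++ map (cat U) R) ++ pprod P R.
  by rewrite !catA.
apply: (teq_cancel t1 t2).
  by apply: teq_sum_id (teq_idK _); apply: teq_sum_id (teq_idK _) (teq_symK _ _).
have -> : (map (cat U) Q ++ map (cat U) R ++ pprod P Q) ++ pprod P R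
  = map (cat U) (Q ++ R) ++ pprod P Q ++ pprod P R.
  by rewrite map_cat !catA.
exact: teq_sum_id (teq_idK _) ih.
Qed.

End Tapes.

(* Main.v *)
From mathcomp Require Import ssreflect ssrfun ssrbool eqtype ssrnat seq.
Require Import Defs.

(** The relation [tle' (whisk_closure I)] has to be shown closed under the
    product, i.e. under left and right whiskering by polynomials.  Right
    whiskering by a monomial preserves it because [R_U (R_V t) = R_(VU) t].
    Left whiskering is conjugate to right whiskering: the symmetries of the
    circuits give isomorphisms [U (x) P -> P (x) U] that are natural in [P] for
    all tapes, so [L_U t] is [R_U t] up to pre- and postcomposition.  Conversely
    [R_U t] is [t (x) id_U], so the whiskered axioms hold in [tle I]. *)

Set Implicit Arguments.
Unset Strict Implicit.
Unset Printing Implicit Defensive.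

Section Whiskering.
Variable Sg : signature.
Implicit Types (t s r f g h : tape Sg) (c d : circuit Sg).
Implicit Types (U V W : word Sg) (P Q R S : poly Sg).

Local Open Scope tape_scope.

(** * Typed forms of the laws, and pasting of commuting squares *)

Lemma teq_typed t s P Q : typed t P Q -> teq t s -> typed s P Q.
Proof. by move=> [_ <- <-] /teq_parallel[_ ? -> ->]. Qed.

Lemma teq_typedC t s P Q : typed t P Q -> teq s t -> typed s P Q.
Proof. by move=> tt /teq_sym /(teq_typed tt). Qed.

Lemma teq_typed_refl t P Q : typed t P Q -> teq t t.
Proof. by case=> w _ _; apply: teq_refl. Qed.

Lemma teq_compl t t' s P Q R : typed t P Q -> typed s Q R ->
  teq t t' -> teq (t ;; s) (t' ;; s).
Proof.
by move=> [_ _ e] [w e' _] h; apply: teq_comp h (teq_refl w); rewrite e e'.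
Qed.

Lemma teq_compr t s s' P Q R : typed t P Q -> typed s Q R ->
  teq s s' -> teq (t ;; s) (t ;; s').
Proof.
by move=> [w _ e] [_ e' _] h; apply: teq_comp (teq_refl w) h; rewrite e e'.
Qed.

Lemma teq_assoc t s r P Q R S : typed t P Q -> typed s Q R -> typed r R S ->
  teq (t ;; s ;; r) (t ;; (s ;; r)).
Proof.
move=> [wt _ ct] [ws ds cs] [wr dr _]; apply: teq_compA.
by rewrite /= ct ds cs dr.
Qed.

Lemma teq_idPl t P Q : typed t P Q -> teq (idP P ;; t) t.
Proof. by case=> w <- _; apply: teq_idl. Qed.

Lemma teq_idPr t P Q : typed t P Q -> teq (t ;; idP Q) t.
Proof. by case=> w _ <-; apply: teq_idr. Qed.

Lemma teq_idP1 U : teq (idP [:: U]) (TId U).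
Proof. exact: (@teq_unitr _ (TId U)). Qed.

Lemma typed_TId U : typed (TId U) [:: U] [:: U].
Proof. by []. Qed.

Lemma teq_exchange t t' s s' P Q R P' Q' R' :
  typed t P Q -> typed t' Q R -> typed s P' Q' -> typed s' Q' R' ->
  teq ((t ;; t') <+> (s ;; s')) ((t <+> s) ;; (t' <+> s')).
Proof.
move=> h1 h2 h3 h4; apply: teq_interchange.
  by case: (typed_comp h1 h2).
by case: (typed_comp h3 h4).
Qed.

Lemma teq_square_comp P Q R P' Q' R' t t' s s' f g h :
    typed t P Q -> typed t' Q R -> typed s P' Q' -> typed s' Q' R' ->
    typed f P P' -> typed g Q Q' -> typed h R R' ->
    teq (t ;; g) (f ;; s) -> teq (t' ;; h) (g ;; s') ->
  teq ((t ;; t') ;; h) (f ;; (s ;; s')).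
Proof.
move=> tt tt' ts ts' tf tg th e e'.
apply: teq_trans (teq_assoc tt tt' th) _.
apply: teq_trans (teq_compr tt (typed_comp tt' th) e') _.
apply: teq_trans (teq_sym (teq_assoc tt tg ts')) _.
apply: teq_trans (teq_compl (typed_comp tt tg) ts' e) _.
exact: teq_assoc tf ts ts'.
Qed.

Lemma teq_square_sum P Q R S P' Q' R' S' t t' s s' f f' g g' :
    typed t P Q -> typed t' R S -> typed s P' Q' -> typed s' R' S' ->
    typed f P P' -> typed g Q Q' -> typed f' R R' -> typed g' S S' ->
    teq (t ;; g) (f ;; s) -> teq (t' ;; g') (f' ;; s') ->
  teq ((t <+> t') ;; (g <+> g')) ((f <+> f') ;; (s <+> s')).
Proof.
move=> tt tt' ts ts' tf tg tf' tg' e e'.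
apply: teq_trans (teq_sym (teq_exchange tt tg tt' tg')) _.
apply: teq_trans (teq_sum e e') _.
exact: teq_exchange tf ts tf' ts'.
Qed.

(** Serves to replace the sides of a naturality square by simpler representatives: [twist] at one or
    two monomials carries a trailing [TId0], and at a concatenation it is a sum only up to [teq]. *)
Lemma teq_square_congr P Q P' Q' t s f f' g g' :
    typed t P Q -> typed s P' Q' -> typed f' P P' -> typed g' Q Q' ->
    teq f f' -> teq g g' ->
  teq (t ;; g') (f' ;; s) -> teq (t ;; g) (f ;; s).
Proof.
move=> tt ts tf tg ef eg e.
apply: teq_trans (teq_compr tt (teq_typedC tg eg) eg) _.
exact: teq_trans e (teq_sym (teq_compl (teq_typedC tf ef) ts ef)).
Qed.

(** * Functoriality of right whiskering by a monomial *)

Lemma whiskR_idP U P : whiskR U (idP P) = idP (map (cat^~ U) P).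
Proof. by elim: P => //= V P ->. Qed.

Lemma whiskR_symU U V Q :
  whiskR U (symU V Q) = symU (V ++ U) (map (cat^~ U) Q).
Proof. by elim: Q => //= W Q ->; rewrite whiskR_idP. Qed.

Lemma whiskR_symP U P Q :
  whiskR U (symP P Q) = symP (map (cat^~ U) P) (map (cat^~ U) Q).
Proof.
elim: P => [|V P ih] /=; first exact: whiskR_idP.
by rewrite ih whiskR_symU whiskR_idP.
Qed.

Lemma whiskR_wf U t : wf t -> wf (whiskR U t).
Proof. by move=> /typed_wf /(typed_whiskR U)[]. Qed.

Lemma whiskR_dom U t : dom (whiskR U t) = map (cat^~ U) (dom t).
Proof. by elim: t => //= t -> s ->; rewrite map_cat. Qed.

Lemma whiskR_cod U t : cod (whiskR U t) = map (cat^~ U) (cod t).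
Proof. by elim: t => //= t -> s ->; rewrite map_cat. Qed.

(** Each law of tapes is mapped to an instance of the same law, because whiskering acts on the
    constructors and commutes with [idP] and [symP] on the nose. Only the laws on circuits need the
    tensor of circuits to be a functor. *)
Lemma teq_whiskR U t s : teq t s -> teq (whiskR U t) (whiskR U s).
Proof.
have idU : cwf (CId U) by [].
elim=> {t s} /=; [by move=> t w; apply: teq_refl; apply: whiskR_wf|..];
  try by intros; constructor.
- by move=> t s r _ h _; apply: teq_trans h.
- by move=> t t' s s' e _ h _ h'; apply: teq_comp h h';
    rewrite whiskR_dom whiskR_cod e.
- by move=> t s r /(@whiskR_wf U (t ;; s ;; r)); apply: teq_compA.
- by move=> t /(whiskR_wf U) /teq_idl; rewrite whiskR_idP whiskR_dom.
- by move=> t /(whiskR_wf U) /teq_idr; rewrite whiskR_idP whiskR_cod.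
- by move=> t s r /(@whiskR_wf U (t <+> s <+> r)); apply: teq_sumA.
- by move=> t /(whiskR_wf U) /teq_unitl.
- by move=> t /(whiskR_wf U) /teq_unitr.
- move=> t t' s s' /(@whiskR_wf U (t ;; t')) w /(@whiskR_wf U (s ;; s')).
  exact: teq_interchange.
- by move=> P Q; rewrite !whiskR_symP whiskR_idP map_cat; apply: teq_symK.
- move=> t s /(whiskR_wf U) w /(whiskR_wf U) /(teq_sym_nat w).
  by rewrite !whiskR_symP !whiskR_dom !whiskR_cod.
- move=> c w; exact: (@teq_merge_nat _ (CTens c (CId U))).
- move=> c w; exact: (@teq_init_nat _ (CTens c (CId U))).
- by move=> c d e; apply: teq_circ; apply: ceq_tens e (ceq_refl _).
- move=> V; apply: teq_trans (teq_circ_id _); apply: teq_circ.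
  exact: ceq_tens_id.
- move=> c d w; have [wc wd e] := w.
  (* Expanding [CId U] as a composite of two copies of itself makes the interchange law of circuits
     applicable. *)
  have w2 : cwf (CComp (CId U) (CId U)) by [].
  apply: (@teq_trans _ _
    (TCirc (CComp (CTens c (CId U)) (CTens d (CId U))))).
    apply: teq_circ; apply: ceq_trans (ceq_interchange w w2).
    apply: ceq_tens; first exact: ceq_refl.
    exact: ceq_sym (@ceq_idl _ (CId U) _).
  by apply: teq_circ_comp; split; rewrite /= ?e.
Qed.

(** On objects this is associativity of concatenation, an equality of sequences; an equation is left
    to prove only at circuits, where the tensor is associative up to [ceq]. *)
Lemma teq_whiskR_whiskR U V t : wf t ->
  teq (whiskR U (whiskR V t)) (whiskR (V ++ U) t).
Proof.
elim: t => /=; try by intros; rewrite -?catA; apply: teq_refl.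
- move=> c w; apply: teq_circ.
  apply: ceq_trans (ceq_tensA _) _ => //.
  by apply: ceq_tens; [apply: ceq_refl | apply: ceq_tens_id].
- move=> t iht s ihs [wt ws e]; apply: teq_comp; [|exact: iht|exact: ihs].
  by rewrite !(whiskR_dom, whiskR_cod) e.
- by move=> t iht s ihs [wt ws]; apply: teq_sum; [exact: iht|exact: ihs].
Qed.

(** * Left whiskering as a conjugate of right whiskering *)

(** The symmetry of the product between the monomial [U] and the polynomial [P]: both objects list
    their monomials in the order of [P], so it is a plain sum of circuit symmetries. *)
Fixpoint twist U P : tape Sg :=
  if P is V :: P' then TCirc (CSym U V) <+> twist U P' else TId0.

Fixpoint twist_inv U P : tape Sg :=
  if P is V :: P' then TCirc (CSym V U) <+> twist_inv U P' else TId0.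

Lemma typed_twist U P : typed (twist U P) (map (cat U) P) (map (cat^~ U) P).
Proof.
elim: P => //= V P; exact: (@typed_sum _ _ _ [:: U ++ V] [:: V ++ U]).
Qed.

Lemma typed_twist_inv U P :
  typed (twist_inv U P) (map (cat^~ U) P) (map (cat U) P).
Proof.
elim: P => //= V P; exact: (@typed_sum _ _ _ [:: V ++ U] [:: U ++ V]).
Qed.

Lemma twistK U P : teq (twist U P ;; twist_inv U P) (idP (map (cat U) P)).
Proof.
elim: P => [|V P ih] /=; first exact: (@teq_idl _ TId0).
apply: (@teq_sum_id _ _ _ _ _ [:: U ++ V]) ih.
apply: teq_trans (teq_sym (teq_idP1 _)).
apply: teq_trans (teq_circ_id _).
apply: teq_trans (teq_circ (ceq_symK _ _)).
by apply: teq_sym; apply: teq_circ_comp.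
Qed.

Lemma twist1 U V : teq (twist U [:: V]) (TCirc (CSym U V)).
Proof. exact: (@teq_unitr _ (TCirc (CSym U V))). Qed.

Lemma twist_cat U P Q : teq (twist U (P ++ Q)) (twist U P <+> twist U Q).
Proof.
have [w _ _] := typed_twist U Q.
elim: P => [|V P ih] /=; first exact: teq_sym (teq_unitl w).
apply: (@teq_trans _ _ (TCirc (CSym U V) <+> (twist U P <+> twist U Q))).
  by apply: teq_sum ih; apply: teq_refl.
apply: teq_sym; apply: teq_sumA.
by have [? _ _] := typed_twist U P.
Qed.

Lemma twist2 U V W :
  teq (twist U [:: V; W]) (TCirc (CSym U V) <+> TCirc (CSym U W)).
Proof. by apply: teq_sum (twist1 _ _); apply: teq_refl. Qed.

(** Bridges the generator [TSym], produced by whiskering, and [symP], in which the naturality law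
    [teq_sym_nat] is stated. *)
Lemma teq_symP1 U V : teq (symP [:: U] [:: V]) (TSym U V).
Proof.
have tV : typed (TSym U V) [:: U; V] [:: V; U] by [].
have id2 W X : teq (TId W <+> TId X) (idP [:: W; X]).
  by apply: teq_sum (teq_sym (teq_idP1 X)); apply: teq_refl.
have e1 : teq (symU U [:: V]) (TSym U V).
  apply: teq_trans (teq_idPr tV).
  by apply: teq_comp (id2 _ _) => //; apply: teq_unitr.
have e2 : teq (symU U [:: V] <+> TId0) (TSym U V).
  by apply: teq_trans e1; apply: teq_unitr.
apply: teq_trans (teq_idPl tV).
by apply: teq_comp e2 => //; apply: teq_refl.
Qed.

(** By induction on [t]. Every component of [twist] is a circuit, so the structural generators
    commute with it by their own naturality; composites and sums follow by pasting squares. *)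
Lemma twist_nat U t : wf t ->
  teq (whiskL U t ;; twist U (cod t)) (twist U (dom t) ;; whiskR U t).
Proof.
have tC1 V : typed (TCirc (CSym U V)) [:: U ++ V] [:: V ++ U] by [].
elim: t => [_|V _|c w|V W _|V _|V _|V _|V _|t iht s ihs [wt ws e]|
            t iht s ihs [wt ws]] /=.
- exact: teq_refl.
- apply: (teq_square_congr (typed_TId _) (typed_TId _) (tC1 V) (tC1 V)
    (twist1 U V) (twist1 U V)).
  apply: (@teq_trans _ _ (TCirc (CSym U V))).
    apply: teq_trans (teq_idPl (tC1 V)).
    exact: teq_compl (typed_TId _) (tC1 V) (teq_sym (teq_idP1 _)).
  apply: teq_trans (teq_sym (teq_idPr (tC1 V))) _.
  exact: teq_compr (tC1 V) (typed_id _) (teq_idP1 _).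
- apply: (@teq_square_congr [:: _] [:: _] [:: _] [:: _] _ _ _ _ _ _ _ _
    (tC1 _) (tC1 _) (twist1 _ _) (twist1 _ _)) => //.
  (* Both sides are gathered into a single circuit, where the equation is naturality of the circuit
     symmetry for [CId U] and [c]. *)
  apply: teq_trans (teq_sym (teq_circ_comp _)) _; first by split.
  apply: teq_trans (teq_circ_comp _); last by split.
  by apply: teq_circ; apply: (@ceq_sym_nat _ (CId U)).
- have tS X Y : typed (symP [:: X] [:: Y]) [:: X; Y] [:: Y; X].
    exact: (typed_sym [:: X] [:: Y]).
  apply: (@teq_square_congr [:: _; _] [:: _; _] [:: _; _] [:: _; _]
    _ _ _ _ _ _ _ _ _ _ (twist2 _ _ _) (twist2 _ _ _)) => //.
  (* With [TSym] traded for [symP] at singletons, this is naturality of the sum symmetry at two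
     circuit symmetries. *)
  apply: (@teq_trans _ _ (symP [:: U ++ V] [:: U ++ W] ;;
      (TCirc (CSym U W) <+> TCirc (CSym U V)))).
    by apply: (@teq_compl _ _ _ [:: _; _] [:: _; _] [:: _; _]) => //;
      apply: teq_sym; apply: teq_symP1.
  apply: (@teq_trans _ _ ((TCirc (CSym U V) <+> TCirc (CSym U W)) ;;
      symP [:: V ++ U] [:: W ++ U])).
    exact: teq_sym (@teq_sym_nat _ (TCirc (CSym U V)) (TCirc (CSym U W)) _ _).
  apply: (@teq_compr _ _ _ [:: _; _] [:: _; _] [:: _; _]) => //.
  exact: teq_symP1.
(* Here and in the next three cases the law used is naturality of the (co)monoid structure at the
   circuit [CSym U V]. *)
- apply: (@teq_square_congr [:: _] [:: _; _] [:: _] [:: _; _]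
    _ _ _ _ _ _ _ _ _ _ (twist1 _ _) (twist2 _ _ _)) => //.
  exact: teq_sym (@teq_copy_nat _ (CSym U V) _).
- apply: (@teq_square_congr [:: _] [::] [:: _] [::]
    _ _ _ _ _ (idP [::]) _ _ _ _ (twist1 _ _) (teq_refl _)) => //.
  apply: teq_trans (@teq_idr _ (TDisc _) _) _ => //.
  exact: teq_sym (@teq_disc_nat _ (CSym U V) _).
- apply: (@teq_square_congr [:: _; _] [:: _] [:: _; _] [:: _]
    _ _ _ _ _ _ _ _ _ _ (twist2 _ _ _) (twist1 _ _)) => //.
  exact: (@teq_merge_nat _ (CSym U V) _).
- apply: (@teq_square_congr [::] [:: _] [::] [:: _]
    _ _ _ (idP [::]) _ _ _ _ _ _ (teq_refl _) (twist1 _ _)) => //.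
  apply: teq_trans (teq_sym (@teq_idl _ (TInit _) _)) => //.
  exact: (@teq_init_nat _ (CSym U V) _).
- have tt := typed_wf wt; have ts := typed_wf ws.
  rewrite -e in ihs ts.
  by apply: (teq_square_comp (typed_whiskL U tt) (typed_whiskL U ts)
    (typed_whiskR U tt) (typed_whiskR U ts) (typed_twist _ _)
    (typed_twist _ _) (typed_twist _ _) (iht wt) (ihs ws)).
- have tt := typed_wf wt; have ts := typed_wf ws.
  apply: (teq_square_congr (typed_sum (typed_whiskL U tt) (typed_whiskL U ts))
    (typed_sum (typed_whiskR U tt) (typed_whiskR U ts))
    (typed_sum (typed_twist _ _) (typed_twist _ _))
    (typed_sum (typed_twist _ _) (typed_twist _ _))
    (twist_cat _ _ _) (twist_cat _ _ _)).
  by apply: (teq_square_sum (typed_whiskL U tt) (typed_whiskL U ts)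
    (typed_whiskR U tt) (typed_whiskR U ts) (typed_twist _ _)
    (typed_twist _ _) (typed_twist _ _) (typed_twist _ _) (iht wt) (ihs ws)).
Qed.

(** Insert [twist] followed by its inverse after [whiskL U t], then move [twist] to the front by
    naturality. *)
Lemma teq_whiskL_conj U t : wf t ->
  teq (whiskL U t) (twist U (dom t) ;; whiskR U t ;; twist_inv U (cod t)).
Proof.
move=> w; have tL := typed_whiskL U (typed_wf w).
have tT := typed_twist U (cod t); have tI := typed_twist_inv U (cod t).
apply: teq_trans (teq_sym (teq_idPr tL)) _.
apply: teq_trans (teq_sym (teq_compr tL (typed_comp tT tI) (twistK _ _))) _.
apply: teq_trans (teq_sym (teq_assoc tL tT tI)) _.
exact: teq_compl (typed_comp tL tT) tI (twist_nat U w).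
Qed.

(** * Right whiskering as the product with an identity *)

(** With an empty last argument each symmetry in the distributor has an empty first argument, where
    [symP] reduces to an identity. *)
Lemma distl0r P Q : teq (distl P Q [::]) (idP (pprod P Q)).
Proof.
elim: P => [|U P ih] /=; first exact: teq_refl.
rewrite cats0 pprod0 /=.
have tA := typed_id (map (cat U) Q).
have tB := typed_id (pprod P Q).
have wA : wf (idP (map (cat U) Q)) by have [] := tA.
have e : teq (idP (map (cat U) Q) <+> idP (pprod P Q) <+> TId0)
             (idP (pprod (U :: P) Q)).
  by apply: teq_trans (teq_id_cat _ _); apply: teq_unitr; split=> //; case: tB.
apply: teq_trans (teq_idK _).
apply: teq_comp e; last first.
  apply: teq_trans (teq_id_cat _ _).
  by apply: teq_sum ih; apply: teq_refl.
rewrite /= cats0; have [_ _ ->] := typed_distl P Q [::].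
have [_ -> ->] := tA; have [_ -> _] := tB.
by rewrite pprod0 cats0.
Qed.

(** Here the empty argument of [symP] is the second one, on which it does not reduce; instead, an
    inverse of an identity is an identity. *)
Lemma distl_inv0r P Q : teq (distl_inv P Q [::]) (idP (pprod P Q)).
Proof.
have tD := typed_distl_inv P Q [::]; rewrite cats0 in tD.
have eD := distl0r P Q; have := distl_invK P Q [::].
rewrite pprod0 cats0 in tD *; apply: teq_trans.
apply: teq_trans (teq_sym (teq_idPr tD)) (teq_sym _).
have tD' := teq_typedC (typed_id _) eD.
exact: teq_compr tD tD' eD.
Qed.

Lemma whiskLP_id P U : whiskLP P (TId U) = idP (map (cat^~ U) P).
Proof. by elim: P => //= V P ->. Qed.

(** The left factor [whiskLP (dom t) (TId U)] is an identity, and the distributors in [whiskRP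
    [:: U] t] are identities since the rest of [[:: U]] is empty. *)
Lemma teq_tens_id U t : wf t -> teq (tens t (TId U)) (whiskR U t).
Proof.
move=> w; have tt := typed_wf w; have tR := typed_whiskR U tt.
have tRP := typed_whiskRP [:: U] tt; rewrite !pprod1 in tRP.
rewrite /tens whiskLP_id.
apply: teq_trans (teq_idPl tRP) _ => /=.
have eR : teq (whiskR U t <+> TId0) (whiskR U t).
  by apply: teq_unitr; case: tR.
have e1 := distl0r (dom t) [:: U]; have e2 := distl_inv0r (cod t) [:: U].
rewrite !pprod1 in e1 e2.
have t1 := teq_typedC (typed_id _) e1.
have t2 := teq_typedC (typed_id _) e2.
have tR0 := teq_typedC tR eR.
apply: teq_trans (teq_idPr tR).
apply: teq_comp e2.
  by have [_ _ ->] := typed_comp t1 tR0; have [_ ->] := t2.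
apply: teq_trans (teq_idPl tR).
apply: teq_comp e1 eR.
by have [_ _ ->] := t1; have [_ ->] := tR0.
Qed.

(** * Closure under the product, for a relation stable under right whiskering *)

Section Closure.
Variable J : tape Sg -> tape Sg -> Prop.
Hypothesis hJ : forall t s, J t s -> parallel t s.

(** The twists, the distributors and the product are built from domains and codomains, so related
    tapes must share them. *)
Lemma tle'_parallel t s : tle' J t s -> parallel t s.
Proof.
elim=> {t s} [t s /hJ //|t s /teq_parallel //|t s r _ h1 _ h2|
              t1 t2 s1 s2 _ h1 _ h2|t1 t2 s1 s2 e _ h1 _ h2].
- by case: h1 h2 => [? ? e1 e2] [? ? e3 e4]; split=> //; congruence.
- by case: h1 h2 => [? ? e1 e2] [? ? e3 e4]; split=> //=; congruence.
- by case: h1 h2 => [? ? e1 e2] [? ? e3 e4]; split=> //=; split=> //;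
    congruence.
Qed.

(** The common shape of [teq_whiskL_conj] and of the recursive clause of [whiskRP]: a tape enclosed
    between two fixed ones. *)
Lemma tle'_sandwich f g t s P Q R S :
  typed f P Q -> typed g R S -> typed t Q R -> tle' J t s ->
  tle' J (f ;; t ;; g) (f ;; s ;; g).
Proof.
move=> tf tg tt le; have ct : cod t = dom g.
  by have [_ _ ->] := tt; have [_ -> _] := tg.
apply: tle'_comp => //; last by apply: tle'_refl; apply: (teq_typed_refl tg).
apply: tle'_comp => //; last by apply: tle'_refl; apply: (teq_typed_refl tf).
by have [_ _ ->] := tf; have [_ -> _] := tt.
Qed.

(** The conclusion lies in [tle' J] and not in [J] because iterated whiskering collapses to a single
    one only up to [teq]. *)
Hypothesis J_whiskR : forall U t s, J t s ->
  tle' J (whiskR U t) (whiskR U s).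

Lemma tle'_whiskR U t s : tle' J t s -> tle' J (whiskR U t) (whiskR U s).
Proof.
elim=> {t s} [t s /J_whiskR //|t s /(teq_whiskR U) /tle'_refl //|
              t s r _ h1 _ h2|t1 t2 s1 s2 _ h1 _ h2|t1 t2 s1 s2 e _ h1 _ h2] /=.
- exact: tle'_trans h1 h2.
- exact: tle'_sum.
- by apply: tle'_comp; rewrite // whiskR_dom whiskR_cod e.
Qed.

Lemma tle'_whiskL U t s : tle' J t s -> tle' J (whiskL U t) (whiskL U s).
Proof.
move=> le; have [wt ws ed ec] := tle'_parallel le.
apply: tle'_trans (tle'_refl _ (teq_whiskL_conj U wt)) _.
apply: tle'_trans (tle'_refl _ (teq_sym (teq_whiskL_conj U ws))).
rewrite -ed -ec; apply: tle'_sandwich (tle'_whiskR U le).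
- exact: typed_twist.
- exact: typed_twist_inv.
- exact: typed_whiskR.
Qed.

Lemma tle'_whiskLP P t s : tle' J t s -> tle' J (whiskLP P t) (whiskLP P s).
Proof.
move=> le; elim: P => [|U P ih] /=; first by apply: tle'_refl; apply: teq_refl.
exact: tle'_sum (tle'_whiskL U le) ih.
Qed.

Lemma tle'_whiskRP P t s : tle' J t s -> tle' J (whiskRP P t) (whiskRP P s).
Proof.
move=> le; elim: P => [|U P ih] /=; first by apply: tle'_refl; apply: teq_refl.
have [wt _ <- <-] := tle'_parallel le; have tt := typed_wf wt.
apply: tle'_sandwich (tle'_sum (tle'_whiskR U le) ih).
- exact: typed_distl.
- exact: typed_distl_inv.
- by rewrite !pprod1; apply: typed_sum (typed_whiskR U tt) (typed_whiskRP P tt).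
Qed.

(** A product is a composite of two polynomial whiskerings, whose indices [dom t1] and [cod s1]
    agree with [dom t2] and [cod s2]. *)
Lemma tle'_tens t1 t2 s1 s2 : tle' J t1 t2 -> tle' J s1 s2 ->
  tle' J (tens t1 s1) (tens t2 s2).
Proof.
move=> le1 le2; have [w1 _ ed _] := tle'_parallel le1.
have [w2 _ _ ec] := tle'_parallel le2.
rewrite /tens -ed -ec; apply: tle'_comp.
- have [_ _ ->] := typed_whiskLP (dom t1) (typed_wf w2).
  by have [_ -> _] := typed_whiskRP (cod s1) (typed_wf w1).
- exact: tle'_whiskLP.
- exact: tle'_whiskRP.
Qed.

End Closure.

(** * The two inclusions *)

Variable I : tape Sg -> tape Sg -> Prop.
Hypothesis hI : forall t s, I t s -> parallel t s.

Lemma whisk_closure_parallel t s : whisk_closure I t s -> parallel t s.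
Proof.
case=> U [t1] [s1] [/hI[wt ws ed ec] -> ->].
by split; rewrite ?whiskR_dom ?whiskR_cod ?ed ?ec //; apply: whiskR_wf.
Qed.

Lemma whisk_closure_whiskR U t s : whisk_closure I t s ->
  tle' (whisk_closure I) (whiskR U t) (whiskR U s).
Proof.
case=> V [t1] [s1] [Its -> ->]; have [wt ws _ _] := hI Its.
apply: tle'_trans (tle'_refl _ (teq_whiskR_whiskR U V wt)) _.
apply: tle'_trans (tle'_refl _ (teq_sym (teq_whiskR_whiskR U V ws))).
(* [V] was attached first, so [U] ends up to its right. *)
by apply: tle'_base; exists (V ++ U), t1, s1.
Qed.

Lemma teq_whiskR_nil t : wf t -> teq (whiskR [::] t) t.
Proof.
elim: t => /=; try by intros; rewrite ?cats0; apply: teq_refl.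
- by move=> c w; apply: teq_circ; apply: ceq_unitr.
- move=> t iht s ihs [wt ws e]; apply: teq_comp; [|exact: iht|exact: ihs].
  by rewrite whiskR_dom whiskR_cod e.
- by move=> t iht s ihs [wt ws]; apply: teq_sum; [exact: iht|exact: ihs].
Qed.

Lemma tle_tle' t s : tle I t s -> tle' (whisk_closure I) t s.
Proof.
elim=> {t s} [t s Its|t s /tle'_refl //|t s r _ h1 _ h2|
              t1 t2 s1 s2 _ h1 _ h2|t1 t2 s1 s2 _ h1 _ h2|
              t1 t2 s1 s2 e _ h1 _ h2].
- have [wt ws _ _] := hI Its.
  (* A pair of [I] is, up to [teq], its own whiskering by the empty word. *)
  apply: tle'_trans (tle'_refl _ (teq_sym (teq_whiskR_nil wt))) _.
  apply: tle'_trans (tle'_refl _ (teq_whiskR_nil ws)).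
  by apply: tle'_base; exists [::], t, s.
- exact: tle'_trans h1 h2.
- exact: tle'_sum.
- exact: (tle'_tens whisk_closure_parallel whisk_closure_whiskR).
- exact: tle'_comp.
Qed.

Lemma tle'_tle t s : tle' (whisk_closure I) t s -> tle I t s.
Proof.
elim=> {t s} [t s [U [t1] [s1] [Its -> ->]]|t s /tle_refl //|t s r _ h1 _ h2|
              t1 t2 s1 s2 _ h1 _ h2|t1 t2 s1 s2 e _ h1 _ h2].
- have [wt ws _ _] := hI Its.
  (* A whiskered axiom is the product of the axiom with the identity of [U], so closure under the
     product yields it. *)
  apply: tle_trans (tle_refl _ (teq_sym (teq_tens_id U wt))) _.
  apply: tle_trans (tle_refl _ (teq_tens_id U ws)).
  by apply: tle_tens (tle_base Its) (tle_refl _ _); apply: teq_refl.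
- exact: tle_trans h1 h2.
- exact: tle_sum.
- exact: tle_comp.
Qed.

End Whiskering.

Theorem theorem5p15 (Sg : signature) (I : tape Sg -> tape Sg -> Prop)
    (hI : forall t1 t2 : tape Sg, I t1 t2 -> parallel t1 t2) :
  forall t1 t2 : tape Sg, wf t1 -> wf t2 ->
    (tle I t1 t2 <-> tle' (whisk_closure I) t1 t2).
Proof.
by move=> t1 t2 _ _; split; [apply: tle_tle' | apply: tle'_tle].
Qed.
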